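(* Let $n, m, d$ be positive integers with $m<n$, and let $A$ be any $(n,m,d)$-array. Then $P(n,d) \ge \sum_{\tau \in A} P_\tau(n,d)$.
   Context: For permutations $\sigma,\pi$ of $[1\ldots n]=\{1,\dots,n\}$ (written as strings), the Kendall-$\tau$ distance $d(\sigma,\pi)$ is the minimum number of adjacent transpositions needed to transform $\sigma$ into $\pi$. An $(n,d)$-PA is a set of permutations of $[1\ldots n]$ whose pairwise Kendall-$\tau$ distances are all at least $d$, and $P(n,d)$ is the maximum cardinality of an $(n,d)$-PA. For $m<n$, $S_{n,m}$ is the set of permutations of $[1\ldots n]$ in which the symbols $1,\dots,n-m$ appear in increasing order; an $(n,m,d)$-array is a subset of $S_{n,m}$ with pairwise Kendall-$\tau$ distances all at least $d$. For $\tau\in S_{n,m}$, $P_\tau(n,d)$ denotes the maximum cardinality of an $(n,d)$-PA all of whose permutations have each of the $m$ largest symbols $n-m+1,\dots,n$ in the same position as in $\tau$ (the remaining $n-m$ symbols may be in any order in the other positions). *)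

(* Defs.v *)
From mathcomp Require Import all_boot all_order all_fingroup.

Set Implicit Arguments.
Unset Strict Implicit.
Unset Printing Implicit Defensive.

(* A permutation of [1..n], written as a string, is s : 'S_n with s i the symbol
   at position i; positions and symbols are numbered from 0, so that the symbol
   k of [1..n] is the element of 'I_n of value k - 1. *)

Section KendallTau.
Variable n : nat.
Implicit Types s t : 'S_n.

(* (tperm i j * s)%g is the string s with the entries at positions i and j
   exchanged, since (u * s)%g k = s (u k). *)
Definition adj_step s t : bool :=
  [exists i : 'I_n, exists j : 'I_n,
     (j == i.+1 :> nat) && (t == (tperm i j * s)%g)].

Definition reach_in s t (k : nat) : bool :=
  [exists p : k.-tuple 'S_n, path adj_step s p && (last s p == t)].

Lemma reach_inP s t k :
  reflect (exists p, [/\ size p = k, path adj_step s p & last s p = t])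
          (reach_in s t k).
Proof.
apply: (iffP existsP) => [[p /andP[pp /eqP lp]]|[p [sp pp lp]]].
  by exists p; rewrite size_tuple.
by exists (tcast sp (in_tuple p)); rewrite val_tcast pp lp /=.
Qed.

Lemma reach_tperm (i j : 'I_n) s : i < j ->
  exists k, reach_in s (tperm i j * s)%g k.
Proof.
move=> lt_ij; have [e He] : exists e, j = (i + e).+1 :> nat.
  by exists (j - i.+1); rewrite -addSn subnKC.
elim: e => [|e IHe] in i j s lt_ij He *.
  exists 1; apply/reach_inP; exists [:: (tperm i j * s)%g]; split=> //=.
  rewrite andbT; apply/existsP; exists i; apply/existsP; exists j.
  by rewrite He addn0 !eqxx.
have hl : (i + e).+1 < n.
  by apply: ltn_trans (ltn_ord j); rewrite He addnS.
pose l := Ordinal hl.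
have lt_il : i < l by rewrite /= ltnS leq_addr.
have st u : adj_step u (tperm l j * u)%g.
  apply/existsP; exists l; apply/existsP; exists j.
  by rewrite He addnS !eqxx.
have nil : i != l by rewrite -val_eqE /= neq_ltn lt_il.
have nij : i != j by rewrite -val_eqE /= neq_ltn lt_ij.
have Et : tperm i j = (tperm l j * (tperm i l * tperm l j))%g.
  by rewrite -{1}(tpermV l j) -conjgE tpermJ tpermL tpermD // eq_sym.
have [k /reach_inP[p [sp pp lp]]] := IHe i l (tperm l j * s)%g lt_il (erefl _).
exists k.+2; apply/reach_inP; exists ((tperm l j * s)%g :: rcons p (tperm i j * s)%g).
split; first by rewrite /= size_rcons sp.
  by rewrite /= st rcons_path pp lp Et -!mulgA st.
by rewrite /= last_rcons.
Qed.

Lemma ex_reach_in s t : exists k, reach_in s t k.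
Proof.
rewrite -[t](mulgKV s); have [ts -> _] := prod_tpermP (t * s^-1)%g.
elim: ts => [|[i j] ts [k /reach_inP[p [sp pp lp]]]].
  by exists 0; apply/reach_inP; exists [::]; rewrite big_nil mul1g.
rewrite big_cons -mulgA /=; set u := (_ * s)%g in lp *.
have [q [pq lq]] : exists q, path adj_step u q /\ last u q = (tperm i j * u)%g.
  case: (ltngtP i j) => [ij|ij|/val_inj ->].
  - by have [k' /reach_inP[q [_ ? ?]]] := reach_tperm u ij; exists q.
  - by have [k' /reach_inP[q [_ ? ?]]] := reach_tperm u ij; exists q; rewrite tpermC.
  by exists [::]; rewrite tperm1 mul1g.
exists (size (p ++ q)); apply/reach_inP; exists (p ++ q).
by rewrite cat_path last_cat lp pp pq lq.
Qed.

Definition kendall_tau s t : nat := ex_minn (ex_reach_in s t).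

End KendallTau.

Definition is_PA (n d : nat) (A : {set 'S_n}) : bool :=
  [forall s in A, forall t in A, (s != t) ==> (d <= kendall_tau s t)].

Definition max_PA (n d : nat) : nat := \max_(A : {set 'S_n} | is_PA d A) #|A|.

(* (s^-1)%g a is the position of the symbol a in s. *)
Definition sorted_perms (n m : nat) : {set 'S_n} :=
  [set s : 'S_n | [forall a : 'I_n, forall b : 'I_n,
     (a < b < n - m) ==> ((s^-1)%g a < (s^-1)%g b)]].

Definition is_array (n m d : nat) (A : {set 'S_n}) : bool :=
  (A \subset sorted_perms n m) && is_PA d A.

(* The symbols a with n - m <= a are the m largest ones, for m <= n. *)
Definition same_large (n m : nat) (tau s : 'S_n) : bool :=
  [forall a : 'I_n, (n - m <= a) ==> ((s^-1)%g a == (tau^-1)%g a)].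

Definition max_PA_at (n m d : nat) (tau : 'S_n) : nat :=
  \max_(B : {set 'S_n} | is_PA d B && [forall s in B, same_large m tau s]) #|B|.

(* Main.v *)
(* Replacing the small symbols of a string by their increasing rearrangement
   turns an adjacent transposition into the same transposition, or, when it
   exchanges two small symbols, into no change at all.  So this rearrangement
   does not increase Kendall-tau distances.  It sends every string counted by
   P_tau(n,d) to tau, hence optimal arrays chosen for the various tau in A are
   disjoint and their union is still an (n,d)-PA. *)
Require Import Defs.
From mathcomp Require Import all_boot all_order all_fingroup.

Section SortSmall.
Variables n m : nat.
Implicit Types s t u v : 'S_n.

Lemma sorted_permsP {s} :
  reflect (forall a b : 'I_n, a < b < n - m -> (s^-1)%g a < (s^-1)%g b)
          (s \in sorted_perms n m).
Proof.
rewrite inE; apply: (iffP forallP) => [H a b ab|H a].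
  by have /forallP/(_ b)/implyP/(_ ab) := H a.
by apply/forallP => b; apply/implyP/H.
Qed.

Lemma same_largeP {t s} :
  reflect (forall a : 'I_n, n - m <= a -> (s^-1)%g a = (t^-1)%g a)
          (same_large m t s).
Proof.
by apply: (iffP forallP) => H a;
  [move=> /(implyP (H a))/eqP | apply/implyP => /H/eqP].
Qed.

Lemma same_large_sym s t : same_large m s t = same_large m t s.
Proof. by apply: eq_forallb => a; rewrite eq_sym. Qed.

Lemma same_large_small t s (i : 'I_n) :
  same_large m t s -> (s i < n - m) = (t i < n - m).
Proof.
suff lt_st u v : same_large m u v -> v i < n - m -> u i < n - m.
  by move=> st; apply/idP/idP; apply: lt_st; rewrite // same_large_sym.
move=> /same_largeP uv; rewrite !ltnNge; apply: contra => large_ui.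
suff -> : v i = u i by [].
by apply: (canLR (permKV v)); rewrite uv // permK.
Qed.

(** The increasing rearrangement of [s] is handled as a relation, a string of [sorted_perms n m]
    related to [s] by [same_large]; this lemma makes it single-valued. *)
Lemma sorted_same_large_inj u v s :
  u \in sorted_perms n m -> v \in sorted_perms n m ->
  same_large m u s -> same_large m v s -> u = v.
Proof.
move=> su sv /same_largeP us /same_largeP vs.
have large (a : 'I_n) : n - m <= a -> (u^-1)%g a = (v^-1)%g a.
  by move=> la; rewrite -us // vs.
(* If u and v place the symbols below a alike, then the symbol placed by u
   where v places a can only be a or a larger small symbol. *)
have le_step (x y : 'S_n) (a : 'I_n) : x \in sorted_perms n m ->
    (forall b : 'I_n, n - m <= b -> (x^-1)%g b = (y^-1)%g b) ->
    (forall b : 'I_n, b < a -> (x^-1)%g b = (y^-1)%g b) ->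
    (x^-1)%g a <= (y^-1)%g a.
  move=> /sorted_permsP sx lxy bxy; set p := (y^-1)%g a.
  have fixp : (x^-1)%g (x p) = (y^-1)%g (x p) -> x p = a.
    by rewrite permK => /perm_inj.
  have px : p = (x^-1)%g (x p) by rewrite permK.
  case: (leqP (n - m) (x p)) => [/lxy/fixp xpa|small]; first by rewrite px xpa.
  case: (ltngtP (x p) a) => [/bxy/fixp xpa|lt_a|/val_inj xpa].
  - by rewrite px xpa.
  - by rewrite px ltnW // sx // lt_a.
  - by rewrite px xpa.
apply: invg_inj; apply/permP => a.
(* Strong induction on the symbol [a]; [le_step] used in both directions gives equality. *)
have [k] := ubnP (val a); elim: k a => // k IHk a; rewrite ltnS => le_ak.
have IH (b : 'I_n) : b < a -> (u^-1)%g b = (v^-1)%g b.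
  by move=> lt_ba; apply: IHk; apply: leq_trans le_ak.
apply/val_inj/anti_leq/andP; split; apply: le_step => // b Hb.
- by rewrite large.
- by rewrite IH.
Qed.

(** No position lies strictly between [i] and [j], so the exchange can only reverse the pair [i],
    [j] itself. *)
Lemma adj_tperm_lt (i j x y : 'I_n) :
  j = i.+1 :> nat -> x < y -> ~~ ((x == i) && (y == j)) ->
  tperm i j x < tperm i j y.
Proof.
move=> ij lt_xy; rewrite negb_and -!val_eqE /= => nxy.
case: tpermP => [xi|xj|/eqP xi /eqP xj]; case: tpermP => [yi|yj|/eqP yi /eqP yj];
  move: lt_xy nxy; subst; rewrite ?ltnn ?eqxx -?val_eqE /= ?ij //.
- by move=> lt_iy; rewrite [_ < y]ltn_neqAle eq_sym => ->.
- by move=> /ltnW.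
- by move=> /leqW.
- by rewrite orbF ltnS [x <= i]leq_eqVlt => /orP[->|].
Qed.

Lemma adj_step_sort s s' t :
  adj_step s s' -> t \in sorted_perms n m -> same_large m t s ->
  exists t', [/\ t' \in sorted_perms n m, same_large m t' s' &
                 t' = t \/ adj_step t t'].
Proof.
move=> /existsP[i /existsP[j /andP[/eqP ij /eqP ->]]] st ts.
have stP := sorted_permsP st; have tsP := same_largeP ts.
have [/andP[si sj]|nsmall] := boolP ((s i < n - m) && (s j < n - m)).
  (* Positions [i] and [j] hold small symbols in [t] too, so the exchange moves no large symbol. *)
  exists t; split=> //; last by left.
  apply/same_largeP => a la; rewrite invMg tpermV permM tsP // tpermD //.
    by apply: contraTneq si => ->; rewrite (same_large_small _ _ _ ts) permKV -leqNgt.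
  by apply: contraTneq sj => ->; rewrite (same_large_small _ _ _ ts) permKV -leqNgt.
(* Now [i] and [j] do not both hold small symbols in [t], so the same exchange keeps the small ones
   in order. *)
exists (tperm i j * t)%g; split.
- apply/sorted_permsP => a b ab; rewrite invMg tpermV !permM.
  apply: adj_tperm_lt => //; first exact: stP.
  apply: contra nsmall => /andP[/eqP <- /eqP <-].
  rewrite !(same_large_small _ _ _ ts) !permKV.
  by case/andP: ab => lt_ab lt_b; rewrite lt_b (ltn_trans lt_ab).
- by apply/same_largeP => a la; rewrite !invMg tpermV !permM tsP.
right; apply/existsP; exists i; apply/existsP; exists j.
by rewrite ij !eqxx.
Qed.

(** Steps exchanging two small symbols disappear, hence only an inequality between the lengths. *)
Lemma path_sort s p t :
  path (@adj_step n) s p -> t \in sorted_perms n m -> same_large m t s ->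
  exists q, [/\ path (@adj_step n) t q, size q <= size p,
    last t q \in sorted_perms n m & same_large m (last t q) (last s p)].
Proof.
elim: p s t => [|s' p IHp] s t /=; first by exists [::].
move=> /andP[ss' pp] st ts.
have [t' [st' ts' tt']] := adj_step_sort _ _ _ ss' st ts.
have [q [pq sq lq lqs]] := IHp _ _ pp st' ts'.
case: tt' => [<-|tt']; first by exists q; rewrite leqW.
by exists (t' :: q); rewrite /= tt'.
Qed.

Lemma kendall_tau_sort u v s t :
  u \in sorted_perms n m -> v \in sorted_perms n m ->
  same_large m u s -> same_large m v t -> kendall_tau u v <= kendall_tau s t.
Proof.
move=> su sv us vt; rewrite {2}/kendall_tau.
case: ex_minnP => k /reach_inP[p [<- pp lp]] _.
(* A shortest path from [s] to [t] is sorted into one starting at [u]; by uniqueness of the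
   rearrangement of [t], it ends at [v]. *)
have [q [pq le_qp lq lqt]] := path_sort _ _ _ pp su us.
rewrite lp in lqt; rewrite /kendall_tau; case: ex_minnP => l _ min_l.
apply: leq_trans le_qp; apply/min_l/reach_inP; exists q; split=> //.
exact: sorted_same_large_inj lqt vt.
Qed.

End SortSmall.

Lemma is_PAP {n d} {A : {set 'S_n}} :
  reflect {in A &, forall s t, s != t -> d <= kendall_tau s t} (is_PA d A).
Proof.
apply: (iffP forall_inP) => [H s t sA tA|H s sA].
  by have /forall_inP/(_ t tA)/implyP := H s sA.
by apply/forall_inP => t tA; apply/implyP/H.
Qed.

Lemma max_PA_at_attained n m d (tau : 'S_n) :
  exists2 B : {set 'S_n},
    is_PA d B /\ {in B, forall s, same_large m tau s} &
    #|B| = max_PA_at m d tau.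
Proof.
pose P (B : {set 'S_n}) := is_PA d B && [forall s in B, same_large m tau s].
(* The empty set qualifies, so the maximum ranges over a nonempty family and is attained. *)
have P0 : P set0.
  apply/andP; split; first by apply/is_PAP => s t; rewrite inE.
  by apply/forall_inP => s; rewrite inE.
have : 0 < #|P| by apply/card_gt0P; exists set0.
case/(eq_bigmax_cond (fun B : {set 'S_n} => #|B|)) => B /andP[PB /forall_inP HB] eqB.
by exists B; rewrite // -eqB.
Qed.

Theorem theorem7 (n m d : nat) (n_gt0 : 0 < n) (m_gt0 : 0 < m) (d_gt0 : 0 < d)
    (lt_mn : m < n) (A : {set 'S_n}) (arrayA : is_array m d A) :
  max_PA n d >= \sum_(tau in A) max_PA_at m d tau.
Proof.
have /andP[/subsetP sortA /is_PAP PA_A] := arrayA.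
have /fin_all_exists2[B HB cardB] := max_PA_at_attained n m d.
(* Empty sets outside [A] allow a disjoint union indexed by all permutations. *)
pose F tau := if tau \in A then B tau else set0.
have FP tau s : s \in F tau -> [/\ tau \in A, s \in B tau & same_large m tau s].
  rewrite /F; case: ifP => // [Atau Bs|_]; last by rewrite inE.
  by split=> //; have [_ ->] := HB tau.
have PA_F : is_PA d (\bigcup_tau F tau).
  apply/is_PAP => s t /bigcupP[u _ /FP[Au Bs us]] /bigcupP[v _ /FP[Av Bt vt]] nst.
  have [euv|nuv] := eqVneq u v.
    by have [/is_PAP PA_B _] := HB u; apply: PA_B; rewrite // euv.
  (* Strings from different classes are at least as far apart as [u] and [v], which are distinct
     members of [A]. *)
  apply: leq_trans (PA_A _ _ Au Av nuv) _.
  by apply: (@kendall_tau_sort _ m); rewrite ?sortA.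
suff -> : \sum_(tau in A) max_PA_at m d tau = #|\bigcup_tau F tau|.
  exact: (@leq_bigmax_cond _ _ (fun X : {set 'S_n} => #|X|)).
rewrite -sum1_card partition_disjoint_bigcup => [|u v].
  rewrite big_mkcond; apply: eq_bigr => tau _; rewrite sum1_card /F.
  by case: ifP; rewrite ?cards0 ?cardB.
(* A common element [s] would have both [u] and [v] as its rearrangement. *)
apply: contraR => /pred0Pn[s /andP[/FP[Au _ us] /FP[Av _ vs]]].
by apply/eqP/(sorted_same_large_inj _ m u v s); rewrite ?sortA.
Qed.
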